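(* Let $K$ be an absorptive, fully-continuous commutative semiring and $\mathcal{E}\colon(X=P_X)_{X\in\mathbf{X}}$ a polynomial equation system over $K$ with induced operator $F_\mathcal{E}$. Then for each $X\in\mathbf{X}$, \[ \operatorname{lfp}(F_\mathcal{E})_X=\sum_{\substack{T\in\mathcal{T}(\mathcal{E},X)\\ T\text{ finite}}}\mathsf{yd}(T),\qquad \operatorname{gfp}(F_\mathcal{E})_X=\sum_{T\in\mathcal{T}(\mathcal{E},X)}\mathsf{yd}(T). \]
   Context: Absorptive: $1+a=1$ for all $a$ (implies idempotence); natural order $a\le b$ iff $a+b=b$; fully continuous: $\le$ is a complete lattice and $+$, $\cdot$ with a fixed element commute with suprema and infima of nonempty chains. Infinite sums denote suprema; an infinite product is the infimum of its finite subproducts. A polynomial equation system over $K$ with indeterminates $\mathbf{X}=\{X_1,\dots,X_\ell\}$ assigns to each $X$ a polynomial $P_X$ (finite sum $\sum c_i m_i$, distinct monomials $m_i\colon\mathbf{X}\to\mathbb{N}$, coefficients $c_i\ne0$; write $c\cdot m\in P$ for such a pair); $F_\mathcal{E}(\mathbf{a})_X=P_X(\mathbf{a})$; lfp/gfp are w.r.t. the componentwise natural order. A derivation tree $T=(V,E,\mathsf{var},\mathsf{yd})$ is a rooted, possibly infinite tree with labelings $\mathsf{var}\colon V\to\mathbf{X}$, $\mathsf{yd}\colon V\to K$; $\mathsf{mon}(v)=\prod_{w\text{ child of }v}\mathsf{var}(w)$. $T$ is compatible with $\mathcal{E}$ if $\mathsf{yd}(v)\cdot\mathsf{mon}(v)\in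 P_{\mathsf{var}(v)}$ for every node $v$; $\mathcal{T}(\mathcal{E},X)$ is the set of compatible trees with root labeled $X$; $\mathsf{yd}(T)=\prod_{v\in V}\mathsf{yd}(v)$. *)

(* Defs.v *)
From mathcomp Require Import all_boot all_order all_algebra.
From mathcomp Require Export finmap.
From mathcomp Require Export boolp classical_sets functions cardinality.

Set Implicit Arguments.
Unset Strict Implicit.
Unset Printing Implicit Defensive.

Import GRing.Theory.
Local Open Scope classical_set_scope.
Local Open Scope ring_scope.

(* [comPzSemiRingType] does not require 0 != 1, so the zero semiring is allowed. *)

Section NaturalOrder.
Context {K : comPzSemiRingType}.
Implicit Types (a b s : K) (A C : set K).

Definition natle a b : Prop := a + b = b.

Definition is_sup A s : Prop :=
  (forall a, A a -> natle a s) /\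
  (forall b, (forall a, A a -> natle a b) -> natle s b).

Definition is_inf A s : Prop :=
  (forall a, A a -> natle s a) /\
  (forall b, (forall a, A a -> natle b a) -> natle b s).

(* The default value 0 is only returned when the bound does not exist, which
   never happens in a complete lattice; see [ksupP] and [kinfP]. *)
Definition ksup A : K := xget 0 (is_sup A).
Definition kinf A : K := xget 0 (is_inf A).

(* Infimum of all finite subproducts.  In an absorptive semiring it agrees with
   the ordinary product when [I] is finite; see [iprod_fin]. *)
Definition iprod (I : choiceType) (f : I -> K) : K :=
  kinf [set \prod_(i <- B) f i | B in [set: {fset I}]].

End NaturalOrder.

Definition absorptive (K : comPzSemiRingType) : Prop :=
  forall a : K, 1 + a = 1.

Definition complete_lattice (K : comPzSemiRingType) : Prop :=
  forall A : set K, (exists s, is_sup A s) /\ (exists s, is_inf A s).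

Record fully_continuous (K : comPzSemiRingType) : Prop := FullyContinuous {
  fc_complete : complete_lattice K;
  fc_add_sup : forall (a : K) (C : set K), C !=set0 -> total_on C natle ->
    a + ksup C = ksup [set a + c | c in C];
  fc_add_inf : forall (a : K) (C : set K), C !=set0 -> total_on C natle ->
    a + kinf C = kinf [set a + c | c in C];
  fc_mul_sup : forall (a : K) (C : set K), C !=set0 -> total_on C natle ->
    a * ksup C = ksup [set a * c | c in C];
  fc_mul_inf : forall (a : K) (C : set K), C !=set0 -> total_on C natle ->
    a * kinf C = kinf [set a * c | c in C]
}.

Section Systems.
Context (X : finType) (K : comPzSemiRingType).

Definition monomial : Type := {ffun X -> nat}.

(* A polynomial is its coefficient function; [finsupp] is exactly the set of
   monomials with nonzero coefficient. *)
Definition polynomial : Type := {fsfun {ffun X -> nat} -> K with 0}.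

(* [is_term P c m] is "c . m \in P". *)
Definition is_term (P : polynomial) (c : K) (m : monomial) : Prop :=
  m \in finsupp P /\ P m = c.

Definition poly_eval (P : polynomial) (a : {ffun X -> K}) : K :=
  \sum_(m <- finsupp P) P m * \prod_(x : X) a x ^+ (m x).

Definition poly_system : Type := X -> polynomial.

Definition sys_op (E : poly_system) (a : {ffun X -> K}) : {ffun X -> K} :=
  [ffun x => poly_eval (E x) a].

Definition vecle (a b : {ffun X -> K}) : Prop := forall x, natle (a x) (b x).

Definition is_lfp (F : {ffun X -> K} -> {ffun X -> K}) (a : {ffun X -> K}) :=
  F a = a /\ forall b, F b = b -> vecle a b.

Definition is_gfp (F : {ffun X -> K} -> {ffun X -> K}) (a : {ffun X -> K}) :=
  F a = a /\ forall b, F b = b -> vecle b a.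

(* Edges point from parents to children; being a tree with root [root] means
   that every node is reached from [root] by exactly one directed path.  The
   children of a node must be finite in number for [mon] to be a monomial.
   Classically every type is a [choiceType], so this is no restriction on the
   set of nodes. *)
Record dtree := DTree {
  node : choiceType;
  edge : rel node;
  root : node;
  tree_path : forall v, exists! p : seq node, path edge root p /\ last root p = v;
  finite_children : forall v, finite_set [set w | edge v w];
  var : node -> X;
  yd : node -> K
}.

(* The product of the indeterminates [var w], i.e. the exponent of [x] counts
   the children labeled [x]. *)
Definition mon (T : dtree) (v : node T) : monomial :=
  [ffun x => (\sum_(w <- fset_set [set w | edge v w]) (var w == x))%N].

Definition compatible (E : poly_system) (T : dtree) : Prop :=
  forall v : node T, is_term (E (var v)) (yd v) (mon v).

Definition dtrees (E : poly_system) (x : X) (T : dtree) : Prop :=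
  compatible E T /\ var (root T) = x.

Definition finite_tree (T : dtree) : Prop := finite_set [set: node T].

Definition yield (T : dtree) : K := iprod (@yd T).

(* The possibly infinite sum of the yields of all trees satisfying [P].  A plain
   predicate is used because [set dtree] is universe-inconsistent. *)
Definition yield_sum (P : dtree -> Prop) : K :=
  ksup [set s | exists2 T, P T & yield T = s].

End Systems.

Section Facts.
Context (K : comPzSemiRingType).

Lemma ksupP (A : set K) : complete_lattice K -> is_sup A (ksup A).
Proof. by move=> cK; have [[s As] _] := cK A; exact: (xgetPex 0 (ex_intro _ s As)). Qed.

Lemma kinfP (A : set K) : complete_lattice K -> is_inf A (kinf A).
Proof. by move=> cK; have [_ [s As]] := cK A; exact: (xgetPex 0 (ex_intro _ s As)). Qed.

Lemma natle_anti (a b : K) : natle a b -> natle b a -> a = b.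
Proof. by move=> ab ba; rewrite -ba addrC. Qed.

Lemma iprod_fin (I : finType) (f : I -> K) :
  absorptive K -> complete_lattice K -> iprod f = \prod_i f i.
Proof.
move=> absK cK.
have setTE : \prod_i f i = \prod_(i <- [fset i in I]%fset) f i.
  apply: perm_big; apply: uniq_perm; rewrite ?index_enum_uniq ?fset_uniq //.
  by move=> i; rewrite mem_index_enum !inE.
have [lb glb] := kinfP [set \prod_(i <- B) f i | B in [set: {fset I}]] cK.
apply: natle_anti; first by apply: lb; exists [fset i in I]%fset.
apply: glb => _ [B _ <-].
have -> : \prod_(i <- B) f i = \prod_(i | i \in B) f i.
  rewrite -[RHS]big_filter; apply: perm_big; apply: uniq_perm.
  - exact: fset_uniq.
  - by rewrite filter_uniq // index_enum_uniq.
  - by move=> i; rewrite mem_filter mem_index_enum andbT.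
rewrite (bigID (fun i => i \in B)) /=; move: (\prod_(i | i \notin B) f i) => c.
by move: (\prod_(i | i \in B) f i) => b; rewrite /natle -{2}[b]mulr1 -mulrDr addrC absK mulr1.
Qed.

End Facts.

(* Main.v *)
(* Least fixed point: mu is the supremum of the iterates F^n(0). Expanding F^n(0)
   by distributivity over finite sums bounds it by the yields of finite trees;
   conversely the yield of a finite tree is below every fixed point.

   Greatest fixed point: nu is the infimum of the iterates F^n(1), and truncating
   a tree at depth n shows that its yield is below F^n(1). For the converse, fix N
   and describe a tree by the vector counting how often each rule (a monomial of
   some P_X) is applied in it, with counts truncated at N. There are finitely many
   truncated vectors, so the decreasing sets of vectors obtained by unfolding
   the equations n times become stationary; from a vector in the limit set one
   builds coinductively an infinite tree whose truncated count it dominates. Hence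
   nu is below the sum of the truncated yields. By Dickson's lemma over N + {oo}
   a finite set of exponent vectors, independent of N, suffices, and the infimum
   over N can be exchanged with this finite sum. *)

Require Import Defs.
From mathcomp Require Import all_boot all_order all_algebra.
From mathcomp Require Import zify.
Local Open Scope ring_scope.

Set Implicit Arguments.
Unset Strict Implicit.
Unset Printing Implicit Defensive.

Import GRing.Theory.
Local Open Scope classical_set_scope.

(** * The natural order of an absorptive semiring *)

Section AbsorptiveOrder.
Context {K : comPzSemiRingType} (habs : absorptive K).
Implicit Types a b c d : K.

Lemma natle_refl a : natle a a.
Proof. by rewrite /natle -{1 2}[a]mulr1 -mulrDr habs mulr1. Qed.

Lemma natle_trans b a c : natle a b -> natle b c -> natle a c.
Proof. by rewrite /natle => ab bc; rewrite -bc addrA ab. Qed.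

Lemma natle0 a : natle 0 a.
Proof. by rewrite /natle add0r. Qed.

Lemma natle1 a : natle a 1.
Proof. by rewrite /natle addrC habs. Qed.

Lemma natleD {a b c d} : natle a b -> natle c d -> natle (a + c) (b + d).
Proof. by rewrite /natle => ab cd; rewrite addrACA ab cd. Qed.

Lemma natleMl c a b : natle a b -> natle (c * a) (c * b).
Proof. by rewrite /natle -mulrDr => ->. Qed.

Lemma natleM {a b c d} : natle a b -> natle c d -> natle (a * c) (b * d).
Proof.
move=> ab cd; apply: (@natle_trans (a * d)); first exact: natleMl.
by rewrite ![_ * d]mulrC; exact: natleMl.
Qed.

Lemma natle_mulr a b : natle (a * b) a.
Proof. by rewrite -{2}[a]mulr1; apply/natleMl/natle1. Qed.

Lemma natle_exp a m n : (m <= n)%N -> natle (a ^+ n) (a ^+ m).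
Proof. by move=> /subnKC <-; rewrite exprD; exact: natle_mulr. Qed.

Lemma natle_prod (I : eqType) (r : seq I) (F G : I -> K) :
  (forall i, i \in r -> natle (F i) (G i)) ->
  natle (\prod_(i <- r) F i) (\prod_(i <- r) G i).
Proof.
move=> FG; rewrite [X in natle X]big_seq [X in natle _ X]big_seq.
by elim/big_ind2: _ => [|? ? ? ?|]; [exact: natle_refl | exact: natleM | exact: FG].
Qed.

Lemma sum_natle (I : Type) (r : seq I) (P : pred I) (F : I -> K) s :
  (forall i, P i -> natle (F i) s) -> natle (\sum_(i <- r | P i) F i) s.
Proof.
move=> Fs; elim/big_ind: _ => [|a b|//]; first exact: natle0.
by rewrite /natle => as_ bs; rewrite -addrA bs.
Qed.

Lemma natle_sum (I : eqType) (r : seq I) (F : I -> K) i :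
  i \in r -> natle (F i) (\sum_(j <- r) F j).
Proof.
move=> ir; rewrite (perm_big _ (perm_to_rem ir)) big_cons.
by rewrite /natle addrA natle_refl.
Qed.

(** Every element is below 1, so additional factors can only decrease a product. *)
Lemma natle_prod_sub (I : eqType) (s r : seq I) (F : I -> K) :
  uniq s -> {subset s <= r} -> natle (\prod_(i <- r) F i) (\prod_(i <- s) F i).
Proof.
elim: s r => [|i s IHs] r /=; first by rewrite big_nil => _ _; exact: natle1.
case/andP=> is_ us sr; have ir : i \in r by apply: sr; rewrite mem_head.
rewrite (perm_big _ (perm_to_rem ir)) !big_cons; apply/natleMl/IHs => // j js.
have : j \in r by apply: sr; rewrite inE js orbT.
rewrite (perm_mem (perm_to_rem ir)) inE => /orP[/eqP ji|//].
by rewrite ji (negPf is_) in js.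
Qed.

End AbsorptiveOrder.

(** * Limits of monotone sequences and Kleene iteration *)

Section ChainLimits.
Context {K : comPzSemiRingType} (R : K -> K -> Prop).
Implicit Types (a b l : K) (u v : nat -> K).

Definition glb_seq u l :=
  (forall n, R l (u n)) /\ (forall b, (forall n, R b (u n)) -> R b l).

Definition decreasing_seq u := forall m n, (m <= n)%N -> R (u n) (u m).

Definition tends u l := decreasing_seq u /\ glb_seq u l.

(* Stated for an arbitrary relation so that it applies to the natural order and
   to its converse alike. *)
Record chain_continuous := ChainContinuous {
  cc_refl : forall a, R a a;
  cc_trans : forall b a c, R a b -> R b c -> R a c;
  cc_anti : forall a b, R a b -> R b a -> a = b;
  cc_add : forall a b c d, R a b -> R c d -> R (a + c) (b + d);
  cc_mul : forall a b c d, R a b -> R c d -> R (a * c) (b * d);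
  cc_glb : forall u, exists l, glb_seq u l;
  cc_add_glb : forall a u l, tends u l -> glb_seq (fun n => a + u n) (a + l);
  cc_mul_glb : forall a u l, tends u l -> glb_seq (fun n => a * u n) (a * l)
}.

Context (hR : chain_continuous).

Lemma tends_cst a : tends (fun=> a) a.
Proof.
split=> [m n _|]; first exact: cc_refl.
by split=> [n|b ba]; [exact: cc_refl | exact: ba 0%N].
Qed.

(** Joint continuity from separate continuity: the limits are taken one argument at a time, and a
    pair of indices [m], [n] is reduced to the diagonal at [maxn m n] by monotonicity. *)
Lemma tends_op (op : K -> K -> K) u v l l' :
  commutative op ->
  (forall a b c d, R a b -> R c d -> R (op a c) (op b d)) ->
  (forall a w k, tends w k -> glb_seq (fun n => op a (w n)) (op a k)) ->
  tends u l -> tends v l' -> tends (fun n => op (u n) (v n)) (op l l').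
Proof.
move=> opC opM opG ul vl'.
have [ud [ul1 _]] := ul; have [vd [vl1 _]] := vl'.
split=> [m n mn|]; first by apply: opM; [exact: ud | exact: vd].
split=> [n|b bn]; first exact: opM.
rewrite opC; apply: (proj2 (opG l' u l ul)) => m; rewrite opC.
apply: (proj2 (opG (u m) v l' vl')) => n; apply: cc_trans (bn (maxn m n)) _ => //.
by apply: opM; [apply: ud; rewrite leq_maxl | apply: vd; rewrite leq_maxr].
Qed.

Lemma tends_add u v l l' :
  tends u l -> tends v l' -> tends (fun n => u n + v n) (l + l').
Proof. apply: tends_op; [exact: addrC | exact: cc_add | exact: cc_add_glb]. Qed.

Lemma tends_mul u v l l' :
  tends u l -> tends v l' -> tends (fun n => u n * v n) (l * l').
Proof. apply: tends_op; [exact: mulrC | exact: cc_mul | exact: cc_mul_glb]. Qed.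

Lemma tends_ext u v l : u =1 v -> tends u l -> tends v l.
Proof. by move=> /funext ->. Qed.

Lemma tends_exp u l k : tends u l -> tends (fun n => u n ^+ k) (l ^+ k).
Proof.
move=> ul; elim: k => [|k IHk]; first exact: tends_cst.
by rewrite exprS; apply: tends_ext (tends_mul ul IHk) => n; rewrite exprS.
Qed.

Lemma tends_sum (I : Type) (r : seq I) (u : I -> nat -> K) (l : I -> K) :
  (forall i, tends (u i) (l i)) ->
  tends (fun n => \sum_(i <- r) u i n) (\sum_(i <- r) l i).
Proof.
move=> ul; elim: r => [|i r IHr].
  by rewrite big_nil; apply: tends_ext (tends_cst 0) => n; rewrite big_nil.
by rewrite big_cons; apply: tends_ext (tends_add (ul i) IHr) => n; rewrite big_cons.
Qed.

Lemma tends_prod (I : Type) (r : seq I) (u : I -> nat -> K) (l : I -> K) :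
  (forall i, tends (u i) (l i)) ->
  tends (fun n => \prod_(i <- r) u i n) (\prod_(i <- r) l i).
Proof.
move=> ul; elim: r => [|i r IHr].
  by rewrite big_nil; apply: tends_ext (tends_cst 1) => n; rewrite big_nil.
by rewrite big_cons; apply: tends_ext (tends_mul (ul i) IHr) => n; rewrite big_cons.
Qed.

Lemma glb_seq_unique u l l' : glb_seq u l -> glb_seq u l' -> l = l'.
Proof.
by move=> [l1 l2] [l1' l2']; apply: cc_anti => //; [exact: l2' | exact: l2].
Qed.

Context {X : finType} (E : poly_system X K).
Implicit Types f g : {ffun X -> K}.

Lemma sys_op_mono f g :
  (forall x, R (f x) (g x)) -> forall x, R (sys_op E f x) (sys_op E g x).
Proof.
move=> fg x; rewrite !ffunE /poly_eval.
elim/big_ind2: _ => [|? ? ? ?|m _]; first exact: cc_refl.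
  exact: cc_add.
apply: cc_mul; first exact: hR; first exact: cc_refl.
elim/big_ind2: _ => [|? ? ? ?|y _]; first exact: cc_refl.
  exact: cc_mul.
elim: (m y) => [|k IHk]; first exact: cc_refl.
by rewrite !exprS; exact: cc_mul.
Qed.

Lemma sys_op_tends (u : nat -> {ffun X -> K}) f :
  (forall x, tends (fun n => u n x) (f x)) ->
  forall x, tends (fun n => sys_op E (u n) x) (sys_op E f x).
Proof.
move=> uf x; rewrite ffunE /poly_eval.
apply: (@tends_ext (fun n => poly_eval (E x) (u n))) => [n|].
  by rewrite ffunE.
apply: tends_sum => m; apply: tends_mul; first exact: tends_cst.
by apply: tends_prod => y; exact: tends_exp.
Qed.

(** Iteration from the top element [f0] decreases to a limit, which is fixed because the operator
    preserves such limits. For the natural order this starts at 1 and gives the greatest fixed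
    point; for the converse order the top is 0 and it gives the least one. *)
Lemma kleene (f0 : {ffun X -> K}) : (forall f x, R (f x) (f0 x)) ->
  exists f : {ffun X -> K},
    [/\ sys_op E f = f,
        forall x, glb_seq (fun n => iter n (sys_op E) f0 x) (f x) &
        forall g, sys_op E g = g -> forall x, R (g x) (f x)].
Proof.
move=> f0max; pose u n := iter n (sys_op E) f0.
have ud x : decreasing_seq (fun n => u n x).
  have uS n y : R (u n.+1 y) (u n y).
    by elim: n y => [|n IHn] y //=; exact: sys_op_mono.
  move=> m n /subnKC <-; elim: (n - m)%N => [|k IHk].
    by rewrite addn0; exact: cc_refl.
  by rewrite addnS; exact: cc_trans (uS _ _) IHk.
have [f fP] : exists f : X -> K, forall x, glb_seq (fun n => u n x) (f x).
  by have [f fP] := choice (fun x => cc_glb hR (fun n => u n x)); exists f.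
exists (finfun f); have fP' x : tends (fun n => u n x) (finfun f x).
  by rewrite ffunE.
split=> [|x|g gfix x]; first 1 last.
- by case: (fP' x).
- apply: (proj2 (proj2 (fP' x))) => n.
  elim: n x => [|n IHn] x /=; first exact: f0max.
  by rewrite -gfix; exact: sys_op_mono.
(* The shifted sequence tends to the image of the limit by continuity, and to the limit itself
   because dropping the first term of a decreasing sequence keeps its infimum. *)
apply/ffunP=> x; apply: (glb_seq_unique (u := fun n => u n.+1 x)).
  exact: (proj2 (sys_op_tends fP' x)).
have [_ [lb glb]] := fP' x; split=> [n|b bu]; first exact: (lb n.+1).
apply: glb => n; apply: cc_trans (bu n) _ => //; exact: ud.
Qed.

End ChainLimits.

(** * Full continuity as chain continuity for the natural order and its converse *)

Section FullyContinuous.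
Context {K : comPzSemiRingType} (habs : absorptive K) (hcont : fully_continuous K).

Let cK := fc_complete hcont.

Lemma is_inf_kinf (A : set K) l : is_inf A l -> kinf A = l.
Proof.
move=> [lb glb]; have [lb' glb'] := kinfP A cK.
by apply: natle_anti; [exact: glb | exact: glb'].
Qed.

Lemma is_sup_ksup (A : set K) l : is_sup A l -> ksup A = l.
Proof.
move=> [ub lub]; have [ub' lub'] := ksupP A cK.
by apply: natle_anti; [exact: lub' | exact: lub].
Qed.

Lemma glb_natleE (u : nat -> K) l : glb_seq natle u l <-> is_inf (range u) l.
Proof.
split=> -[lb glb]; split.
- by move=> _ [n _ <-].
- by move=> b bu; apply: glb => n; apply: bu; exists n.
- by move=> n; apply: lb; exists n.
- by move=> b bu; apply: glb => _ [n _ <-].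
Qed.

Lemma glb_natgeE (u : nat -> K) l :
  glb_seq (fun a b => natle b a) u l <-> is_sup (range u) l.
Proof.
split=> -[lb glb]; split.
- by move=> _ [n _ <-].
- by move=> b bu; apply: glb => n; apply: bu; exists n.
- by move=> n; apply: lb; exists n.
- by move=> b bu; apply: glb => _ [n _ <-].
Qed.

Lemma range_neq0 (u : nat -> K) : range u !=set0.
Proof. by exists (u 0%N); exists 0%N. Qed.

Lemma natle_chain_continuous : chain_continuous (@natle K).
Proof.
have chain (u : nat -> K) : decreasing_seq natle u -> total_on (range u) natle.
  move=> ud _ _ [m _ <-] [n _ <-].
  by case/orP: (leq_total m n) => /ud; [right | left].
split.
- exact: (natle_refl habs).
- exact: natle_trans.
- exact: natle_anti.
- by move=> *; exact: natleD.
- by move=> *; exact: natleM.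
- by move=> u; have [_ [l lP]] := cK (range u); exists l; apply/glb_natleE.
- move=> a u l [ud /glb_natleE /is_inf_kinf <-]; apply/glb_natleE.
  rewrite (fc_add_inf hcont a (range_neq0 u) (chain u ud)) image_comp.
  exact: kinfP.
- move=> a u l [ud /glb_natleE /is_inf_kinf <-]; apply/glb_natleE.
  rewrite (fc_mul_inf hcont a (range_neq0 u) (chain u ud)) image_comp.
  exact: kinfP.
Qed.

Lemma natge_chain_continuous : chain_continuous (fun a b : K => natle b a).
Proof.
have chain (u : nat -> K) :
    decreasing_seq (fun a b : K => natle b a) u -> total_on (range u) natle.
  move=> ud _ _ [m _ <-] [n _ <-].
  by case/orP: (leq_total m n) => /ud; [left | right].
split.
- exact: (natle_refl habs).
- by move=> b a c ab bc; exact: natle_trans bc ab.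
- by move=> a b ab ba; exact: natle_anti.
- by move=> *; exact: natleD.
- by move=> *; exact: natleM.
- by move=> u; have [[l lP] _] := cK (range u); exists l; apply/glb_natgeE.
- move=> a u l [ud /glb_natgeE /is_sup_ksup <-]; apply/glb_natgeE.
  rewrite (fc_add_sup hcont a (range_neq0 u) (chain u ud)) image_comp.
  exact: ksupP.
- move=> a u l [ud /glb_natgeE /is_sup_ksup <-]; apply/glb_natgeE.
  rewrite (fc_mul_sup hcont a (range_neq0 u) (chain u ud)) image_comp.
  exact: ksupP.
Qed.

End FullyContinuous.

(** * Yields of trees approximated by truncation at finite depth *)

Section TreeYield.
Context {X : finType} {K : comPzSemiRingType} (T : dtree X K).
Implicit Types (v w : node T) (p : seq (node T)).

Definition children v : seq (node T) := fset_set [set w | edge v w].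

Lemma mem_children v w : (w \in children v) = edge v w.
Proof.
rewrite /children in_fset_set; last exact: finite_children.
by apply/idP/idP => [/set_mem|vw] //; exact/mem_set.
Qed.

Lemma children_uniq v : uniq (children v).
Proof. exact: fset_uniq. Qed.

Fixpoint paths n v : seq (seq (node T)) :=
  if n is n'.+1 then [::] :: [seq w :: p | w <- children v, p <- paths n' w]
  else [::].

(** The product of the yields over the part of depth less than [n] below [v], written recursively to
    match the iterates of [sys_op] from 1. *)
Fixpoint pyield n v : K :=
  if n is n'.+1 then yd v * \prod_(w <- children v) pyield n' w else 1.

Lemma mem_paths n v p : (p \in paths n v) = path (@edge _ _ T) v p && (size p < n)%N.
Proof.
elim: n v p => [|n IHn] v [|w p] //=; first by rewrite andbF.
rewrite inE /= ltnS; apply/idP/idP.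
  case/allpairsPdep=> w' [p' [+ + [-> ->]]].
  by rewrite mem_children IHn => -> /andP[-> ->].
case/andP=> /andP[vw wp] pn; apply/allpairsPdep; exists w, p.
by rewrite mem_children IHn vw wp.
Qed.

Lemma paths_uniq n v : uniq (paths n v).
Proof.
elim: n v => [|n IHn] v //=; apply/andP; split.
  by apply/allpairsPdep => -[? [? []]].
apply: allpairs_uniq_dep; first exact: children_uniq.
  by move=> w _; exact: IHn.
by move=> [w p] [w' p'] _ _ /= [-> ->].
Qed.

Lemma pyieldE n v : pyield n v = \prod_(p <- paths n v) yd (last v p).
Proof.
elim: n v => [|n IHn] v /=; first by rewrite big_nil.
rewrite big_cons big_allpairs_dep /=; congr (_ * _).
by apply: eq_bigr => w _; rewrite IHn.
Qed.

Lemma node_path v :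
  exists p, path (@edge _ _ T) (Defs.root T) p /\ last (Defs.root T) p = v.
Proof. by have [p [pP _]] := tree_path v; exists p. Qed.

Lemma path_root_inj p q :
  path (@edge _ _ T) (Defs.root T) p -> path (@edge _ _ T) (Defs.root T) q ->
  last (Defs.root T) p = last (Defs.root T) q -> p = q.
Proof.
move=> pp qq pq; have [r [_ ru]] := tree_path (last (Defs.root T) p).
by rewrite -(ru p) // -(ru q).
Qed.

Lemma ends_uniq n : uniq [seq last (Defs.root T) p | p <- paths n (Defs.root T)].
Proof.
rewrite map_inj_in_uniq ?paths_uniq // => p q; rewrite !mem_paths.
by move=> /andP[pp _] /andP[qq _]; exact: path_root_inj.
Qed.

Lemma mem_ends (B : seq (node T)) :
  exists n, {subset B <= [seq last (Defs.root T) p | p <- paths n (Defs.root T)]}.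
Proof.
elim: B => [|v B [n IHn]]; first by exists 0%N.
have [p [pp pv]] := node_path v.
exists (maxn n (size p).+1) => w; rewrite inE => /orP[/eqP ->|/IHn].
  by apply/mapP; exists p; rewrite // mem_paths pp leq_maxr.
move=> /mapP[q]; rewrite mem_paths => /andP[qq qn] ->.
by apply/mapP; exists q; rewrite // mem_paths qq leq_max qn.
Qed.

(** Paths from the root are determined by their ends, so [pyield] lists each node of depth less than
    [n] once and is one of the finite subproducts. *)
Lemma yield_le_pyield n : complete_lattice K ->
  natle (yield T) (pyield n (Defs.root T)).
Proof.
move=> cK; pose e := [seq last (Defs.root T) p | p <- paths n (Defs.root T)].
have [lb _] := kinfP
  [set \prod_(v <- B) yd v | B in [set: {fset (node T)}]] cK.
apply: lb; exists [fset v in e]%fset => //.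
rewrite pyieldE -(big_map (last (Defs.root T)) xpredT (@yd _ _ T)).
apply: perm_big; apply: uniq_perm; [exact: fset_uniq | exact: ends_uniq |].
by move=> v; rewrite in_fset.
Qed.

(** The truncations are cofinal among the finite subproducts: a finite set of nodes lies within some
    depth, and the further factors only decrease the product. *)
Lemma le_yield a : absorptive K -> complete_lattice K ->
  (forall n, natle a (pyield n (Defs.root T))) -> natle a (yield T).
Proof.
move=> habs cK aP.
have [_ glb] := kinfP
  [set \prod_(v <- B) yd v | B in [set: {fset (node T)}]] cK.
apply: glb => _ [B _ <-]; have [n Bn] := mem_ends B.
apply: natle_trans (aP n) _.
rewrite pyieldE -(big_map (last (Defs.root T)) xpredT (@yd _ _ T)).
by apply: natle_prod_sub => //; exact: fset_uniq.
Qed.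

Lemma big_childrenE (V : Type) (idx : V) (op : Monoid.com_law idx) v
    (cs : seq (node T)) (F : node T -> V) : uniq cs -> cs =i edge v ->
  \big[op/idx]_(w <- children v) F w = \big[op/idx]_(w <- cs) F w.
Proof.
move=> csu csv; apply: perm_big; apply: uniq_perm => //; first exact: children_uniq.
by move=> w; rewrite mem_children csv.
Qed.

Lemma prod_children v (a : X -> K) :
  \prod_(w <- children v) a (var w) = \prod_x a x ^+ mon v x.
Proof.
rewrite [RHS](eq_bigr (fun x => \prod_(w <- children v | var w == x) a x)).
  rewrite (exchange_big_dep xpredT) //=; apply: eq_bigr => w _.
  by rewrite (eq_bigl (pred1 (var w))) ?big_pred1_eq // => x; rewrite eq_sym.
move=> x _; rewrite ffunE expr_sum [RHS]big_mkcond; apply: eq_bigr => w _.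
by case: (var w == x).
Qed.

Context (habs : absorptive K) (E : poly_system X K) (ET : compatible E T).

Lemma compatible_le_sys_op (a : {ffun X -> K}) v :
  natle (yd v * \prod_(w <- children v) a (var w)) (sys_op E a (var v)).
Proof.
have [mE mv] := ET v; rewrite ffunE /poly_eval prod_children -mv.
exact: (natle_sum habs (fun m => E (var v) m * \prod_x a x ^+ m x) mE).
Qed.

Lemma pyield_le_iter n v :
  natle (pyield n v) (iter n (sys_op E) [ffun=> 1] (var v)).
Proof.
elim: n v => [|n IHn] v /=; first by rewrite ffunE; exact: (natle_refl habs).
apply: natle_trans (compatible_le_sys_op _ _).
by apply/natleMl/(natle_prod habs) => w _; exact: IHn.
Qed.

(** The bound on path lengths ensures that the truncation cuts nothing off: at [n = 0] the empty
    path already contradicts it, so the value 1 of [pyield] there never has to be compared with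
    [a]. *)
Lemma pyield_le_fixpoint (a : {ffun X -> K}) n v : sys_op E a = a ->
  (forall p, path (@edge _ _ T) v p -> (size p < n)%N) ->
  natle (pyield n v) (a (var v)).
Proof.
move=> aE; elim: n v => [v /(_ [::] isT) //|n IHn v vn /=].
rewrite -aE; apply: natle_trans (compatible_le_sys_op _ _).
apply/natleMl/(natle_prod habs) => w; rewrite mem_children => vw.
by apply: IHn => p wp; apply: (vn (w :: p)); rewrite /= vw.
Qed.

Lemma finite_yield_le (a : {ffun X -> K}) : complete_lattice K ->
  finite_tree T -> sys_op E a = a -> natle (yield T) (a (var (Defs.root T))).
Proof.
move=> cK /finite_seqP[s sE] aE; have [n sn] := mem_ends s.
apply: natle_trans (yield_le_pyield n cK) _; apply: pyield_le_fixpoint => // p pp.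
have /sn/mapP[q] : last (Defs.root T) p \in s.
  by have : [set: node T] (last (Defs.root T) p) by []; rewrite sE.
by rewrite mem_paths => /andP[qq qn] /(path_root_inj pp qq) ->.
Qed.

Lemma finite_tree_bounded n :
  (forall p, path (@edge _ _ T) (Defs.root T) p -> (size p < n)%N) -> finite_tree T.
Proof.
move=> nP; apply/finite_seqP.
exists [seq last (Defs.root T) p | p <- paths n (Defs.root T)].
apply/seteqP; split=> // v _; have [p [pp pv]] := node_path v.
by apply/mapP; exists p; rewrite // mem_paths pp nP.
Qed.

End TreeYield.

(** * Terms of the system as grammar rules *)

Section Rules.
Context {X : finType} {K : comPzSemiRingType} (E : poly_system X K).

Definition rule : finType := {x : X & finsupp (E x)}.

Definition rule_mon (r : rule) : monomial X := val (tagged r).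
Definition rhead (r : rule) : X := tag r.
Definition rcoef (r : rule) : K := E (rhead r) (rule_mon r).
(** The monomial as a word, so that the children of a node correspond to positions. *)
Definition rbody (r : rule) : seq X :=
  flatten [seq nseq (rule_mon r y) y | y <- enum X].

Lemma prod_rbody (r : rule) (a : X -> K) :
  \prod_(y <- rbody r) a y = \prod_y a y ^+ rule_mon r y.
Proof.
rewrite /rbody big_flatten big_map -[in RHS]big_enum; apply: eq_bigr => y _.
by rewrite big_nseq -Monoid.iteropE.
Qed.

Lemma count_rbody (r : rule) y : count_mem y (rbody r) = rule_mon r y.
Proof.
rewrite /rbody count_flatten -map_comp sumnE big_map big_enum (bigD1 y) //=.
rewrite count_nseq /= eqxx mul1n big1 ?addn0 // => z zy.
by rewrite count_nseq /= (negPf zy).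
Qed.

Lemma sys_opE (a : {ffun X -> K}) x :
  sys_op E a x = \sum_(r | rhead r == x) rcoef r * \prod_(y <- rbody r) a y.
Proof.
rewrite ffunE /poly_eval big_seq_fsetE /=.
pose F y (m : finsupp (E y)) := E y (val m) * \prod_z a z ^+ val m z.
transitivity (\sum_(y | y == x) \sum_(m : finsupp (E y)) F y m).
  by rewrite big_pred1_eq.
rewrite (sig_big_dep _ (fun _ => xpredT) F) /=.
apply: eq_big => [r|r _]; first by rewrite andbT.
by rewrite prod_rbody.
Qed.

Lemma compatible_node (T : dtree X K) (v : node T) (r : rule) (cs : seq (node T)) :
  rhead r = var v -> rcoef r = yd v -> uniq cs -> cs =i edge v ->
  map (@var _ _ T) cs = rbody r -> is_term (E (var v)) (yd v) (mon v).
Proof.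
move=> hv <- csu csv csb.
have -> : mon v = rule_mon r.
  apply/ffunP=> y; rewrite ffunE -/(children v) (big_childrenE _ _ csu csv).
  rewrite -count_rbody -csb count_map -sum1_count [RHS]big_mkcond.
  by apply: eq_bigr => w _ /=; case: eqP.
by rewrite -hv; split => //; exact: valP.
Qed.

End Rules.

(** * Coinductive construction of derivation trees from a state space *)

Section Unfolding.
Context {X : finType} {K : comPzSemiRingType} (E : poly_system X K).
Context (J : Type) (V : X -> J -> Prop).
Context (Q : rule E -> J -> (nat -> J) -> Prop).

(** A rule and successor states are chosen once for each state in [V]; following these choices
    forever from [(x, j)] gives the tree, and [st] records the state at each node. It stops only
    where rules have empty bodies. *)
Lemma unfold x j y0 : V x j ->
  (forall x j, V x j -> exists r f,
     [/\ rhead r = x, Q r j f &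
         forall i, (i < size (rbody r))%N -> V (nth y0 (rbody r) i) (f i)]) ->
  exists (T : dtree X K) (st : node T -> J),
    [/\ dtrees E x T, st (Defs.root T) = j &
        forall v, exists r f,
          [/\ yd v = rcoef r, Q r (st v) f &
              exists cs, [/\ uniq cs, cs =i edge v &
                map st cs = [seq f i | i <- iota 0 (size (rbody r))] ]]].
Proof.
move=> Vxj step.
(* [r0] is a default for states outside [V], which no [ok] list reaches. *)
have [r0 _] := step _ _ Vxj.
have /choice[g gP] : forall s : X * J, exists rf : rule E * (nat -> J),
    V s.1 s.2 -> [/\ rhead rf.1 = s.1, Q rf.1 s.2 rf.2 &
      forall i, (i < size (rbody rf.1))%N -> V (nth y0 (rbody rf.1) i) (rf.2 i)].
  move=> [y k]; have [/step[r [f rf]]|nV] := pselect (V y k).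
    by exists (r, f).
  by exists (r0, fun=> j).
(* A node is the reversed list of the child indices on the way to it. *)
pose st := fix st (p : seq nat) : X * J :=
  if p is i :: q then (nth y0 (rbody (g (st q)).1) i, (g (st q)).2 i) else (x, j).
pose ok := fix ok (p : seq nat) : bool :=
  if p is i :: q then (i < size (rbody (g (st q)).1))%N && ok q else true.
have okV p : ok p -> V (st p).1 (st p).2.
  elim: p => [|i q IHq] //= /andP[iq okq].
  by have [_ _] := gP _ (IHq okq); exact.
pose nodeT : choiceType := {p | ok p}.
pose nroot : nodeT := exist (fun p => ok p) [::] isT.
pose e : rel nodeT := fun v w => if val w is _ :: q then q == val v else false.
(* Nothing is discarded by [pmap insub]: an index within the rule body extends an [ok] list to an
   [ok] list. *)
pose cs (v : nodeT) : seq nodeT :=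
  pmap insub [seq i :: val v | i <- iota 0 (size (rbody (g (st (val v))).1))].
have val_cs v : map val (cs v) =
    [seq i :: val v | i <- iota 0 (size (rbody (g (st (val v))).1))].
  rewrite (pmap_filter (insubK _)); apply/all_filterP/allP => _ /mapP[i + ->].
  rewrite mem_iota /= => iv; rewrite isSome_insub /=.
  by apply/andP; split; [exact: iv | exact: valP v].
have cs_uniq v : uniq (cs v).
  by apply: (map_uniq (f := val)); rewrite val_cs map_inj_uniq ?iota_uniq // => i k [].
have mem_cs v : cs v =i e v.
  move=> w; rewrite -(mem_map val_inj) val_cs [RHS]unfold_in /e.
  case: w => -[|i q] /= okw; first by apply/mapP => -[].
  case/andP: (okw) => iq _.
  apply/mapP/eqP => [[k _ [_ ->]] //|qv]; exists i; rewrite ?qv //.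
  by rewrite mem_iota /= -qv.
have tree v : exists! p, path e nroot p /\ last nroot p = v.
  case: v; elim=> [|i q IHq] okv.
    exists [::]; split; first by split => //; exact: val_inj.
    case/lastP=> // p w [+ wr]; rewrite rcons_path last_rcons in wr *.
    by rewrite wr => /andP[].
  case/andP: (okv) => iq okq; have [p [[pp pq] pu]] := IHq okq.
  exists (rcons p (exist (fun p => ok p) (i :: q) okv)); split.
    by rewrite rcons_path last_rcons pp /= pq /e /= eqxx.
  (* The last edge of a path to [i :: q] must come from [q], so uniqueness is inherited from [q]. *)
  case/lastP=> [[_ /(congr1 val)]//|p' w []].
  rewrite rcons_path last_rcons => /andP[pp' +] wE; rewrite wE /e /= => /eqP qE.
  by rewrite (pu p') //; split => //; exact/val_inj.
have fin v : finite_set [set w | e v w].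
  apply: sub_finite_set (finite_seq (cs v)) => w /= vw.
  by rewrite mem_cs.
pose T := DTree tree fin (fun v => (st (val v)).1)
  (fun v => rcoef (g (st (val v))).1).
have map_st (v : nodeT) : [seq st (val w) | w <- cs v] =
    [seq (nth y0 (rbody (g (st (val v))).1) i, (g (st (val v))).2 i)
      | i <- iota 0 (size (rbody (g (st (val v))).1))].
  by rewrite (map_comp st val) val_cs -map_comp.
exists T, (fun v : nodeT => (st (val v)).2); split=> [||v] //.
  split=> // v; have [hd _ _] := gP _ (okV _ (valP v)).
  apply: (@compatible_node _ _ _ T v _ (cs v) hd) => //.
  rewrite -[LHS]/(map (fst \o (st \o val)) (cs v)) map_comp map_st -map_comp.
  rewrite -[RHS](mkseq_nth y0) /mkseq; exact: eq_map.
have [_ Qv _] := gP _ (okV _ (valP v)).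
exists (g (st (val v))).1, (g (st (val v))).2; split=> //.
exists (cs v); split=> //.
by rewrite -[LHS]/(map (snd \o (st \o val)) (cs v)) map_comp map_st -map_comp.
Qed.

End Unfolding.

(** * Bounding values by families closed under no suprema of chains *)

Section Domination.
Context {X : finType} {K : comPzSemiRingType} (E : poly_system X K).
Context {J : Type} (j0 : J) (y0 : X).

(* [b] lies below every upper bound of the values [v j] with [P j], and this
   remains so after multiplication by any constant: multiplication is not known
   to commute with suprema of sets that are not chains. *)
Definition dominated (P : J -> Prop) (v : J -> K) (b : K) : Prop :=
  forall c s, (forall j, P j -> natle (c * v j) s) -> natle (c * b) s.

Context (P : X -> J -> Prop) (v : J -> K).

(** The factors are replaced one at a time, all the others being absorbed into the constant [c]. *)
Lemma dominated_prod (g : X -> K) : (forall y, dominated (P y) v (g y)) ->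
  forall ys c s,
    (forall f : nat -> J,
       (forall i, (i < size ys)%N -> P (nth y0 ys i) (f i)) ->
       natle (c * \prod_(i <- iota 0 (size ys)) v (f i)) s) ->
    natle (c * \prod_(y <- ys) g y) s.
Proof.
move=> gdom; elim=> [|y ys IHys] c s cs.
  by move: (cs (fun=> j0)); rewrite !big_nil; exact.
rewrite big_cons mulrA; apply: IHys => f fP; rewrite mulrAC; apply: gdom => j yj.
move: (cs (fun i => if i is i'.+1 then f i' else j)).
rewrite /= big_cons (iotaDl 1 0) big_map /= -mulrA [_ * v j]mulrC; apply.
by case=> [|i] //=; exact: fP.
Qed.

Lemma sys_op_dominated (g : {ffun X -> K}) : (forall y, dominated (P y) v (g y)) ->
  forall x c s,
    (forall (r : rule E) (f : nat -> J), rhead r = x ->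
       (forall i, (i < size (rbody r))%N -> P (nth y0 (rbody r) i) (f i)) ->
       natle (c * (rcoef r * \prod_(i <- iota 0 (size (rbody r))) v (f i))) s) ->
    natle (c * sys_op E g x) s.
Proof.
move=> gdom x c s cs; rewrite sys_opE mulr_sumr.
apply: sum_natle => r /eqP rx; rewrite mulrA; apply: dominated_prod => // f fP.
by rewrite -mulrA; exact: cs.
Qed.

End Domination.

(** * Iterates from 0 and finite trees *)

Section LeastFixpoint.
Context {X : finType} {K : comPzSemiRingType} (E : poly_system X K) (y0 : X).
Context (habs : absorptive K).

(* [a] is the yield of a compatible tree of height less than [n]. *)
Fixpoint finite_yield (n : nat) (x : X) (a : K) : Prop :=
  if n is n'.+1 then
    exists (r : rule E) (f : nat -> K),
      [/\ rhead r = x,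
          forall i, (i < size (rbody r))%N -> finite_yield n' (nth y0 (rbody r) i) (f i) &
          a = rcoef r * \prod_(i <- iota 0 (size (rbody r))) f i]
  else False.

Lemma iter0_dominated n x :
  dominated (finite_yield n x) id (iter n (sys_op E) [ffun=> 0] x).
Proof.
elim: n x => [|n IHn] x c s cs /=; first by rewrite ffunE mulr0; exact: natle0.
apply: (sys_op_dominated (y0 := y0) 0 IHn) => r f rx fP.
apply: (cs (rcoef r * \prod_(i <- iota 0 (size (rbody r))) f i)).
by exists r, f.
Qed.

(** Unfolding with states that pair a height bound with a value. The bound drops by one along each
    edge, hence the tree is finite. *)
Lemma finite_yield_tree n x a : complete_lattice K -> finite_yield n x a ->
  exists T : dtree X K, [/\ dtrees E x T, finite_tree T & natle a (yield T)].
Proof.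
move=> cK xa.
pose Q (r : rule E) (j : nat * K) (f : nat -> nat * K) := exists k,
  [/\ j.1 = k.+1, forall i, (f i).1 = k &
      j.2 = rcoef r * \prod_(i <- iota 0 (size (rbody r))) (f i).2].
have [] := @unfold X K E _ (fun y j => finite_yield j.1 y j.2) Q x (n, a) y0 xa.
  move=> y [[|k] b] //= [r [f [rx fP bE]]].
  by exists r, (fun i => (k, f i)); split=> //; exists k.
move=> T [st [ET str stP]]; exists T; split=> //.
  apply: (finite_tree_bounded (n := (st (Defs.root T)).1)) => p.
  elim: p (Defs.root T) => [|w p IHp] v /=.
    by have [r [f [_ [k [-> _ _]]]]] := stP v.
  case/andP=> vw /IHp; have [r [f [_ [k [-> fk _]] [cs [_ csv cst]]]]] := stP v.
  have : st w \in [seq f i | i <- iota 0 (size (rbody r))].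
    by rewrite -cst map_f // csv.
  by case/mapP=> i _ ->; rewrite fk => pk; rewrite ltnS.
apply: le_yield => // n'; rewrite -[a]/((n, a).2) -str.
elim: n' (Defs.root T) => [|n' IHn'] v /=; first exact: natle1.
have [r [f [-> [k [_ _ ->]] [cs [csu csv cst]]]]] := stP v.
rewrite (big_childrenE _ _ csu csv) -(big_map f xpredT snd) -cst big_map.
by apply/natleMl/(natle_prod habs) => w _; exact: IHn'.
Qed.

End LeastFixpoint.

(** * Dickson's lemma for exponents that may be infinite *)

Section Dickson.
Context {R : finType}.
Implicit Types (e f : {ffun R -> option nat}) (A : {ffun R -> option nat} -> Prop).

(* [None] stands for the exponent infinity. *)
Definition leo (a b : option nat) : bool :=
  match a, b with
  | _, None => true
  | None, Some _ => false
  | Some i, Some j => (i <= j)%N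
  end.

(** Induction on the coordinates, splitting [A] at the new one: [s1] covers the infinite values,
    [s2] the finite values from [M] on, and the [s3 j] each single value [j] below [M]. *)
Lemma dickson_seq (l : seq R) A : exists s : seq {ffun R -> option nat},
  (forall f, f \in s -> A f) /\
  forall e, A e -> exists2 f, f \in s & forall r, r \in l -> leo (f r) (e r).
Proof.
elim: l A => [|r l IHl] A.
  have [[e Ae]|A0] := pselect (exists e, A e).
    by exists [:: e]; split=> [f|f _]; [rewrite inE => /eqP -> | exists e; rewrite ?inE].
  by exists [::]; split=> // e Ae; case: A0; exists e.
have [s1 [s1A s1P]] := IHl (fun e => A e /\ e r = None).
have [s2 [s2A s2P]] := IHl (fun e => A e /\ e r <> None).
have /choice[s3 s3P] := fun j => IHl (fun e => A e /\ e r = Some j).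
(* From [M] on, no member of [s2] exceeds the value at [r], so agreement on [l] suffices. *)
pose M := (\max_(f <- s2) odflt 0 (f r))%N.
exists (s1 ++ s2 ++ flatten [seq s3 j | j <- iota 0 M]); split.
  move=> f; rewrite !mem_cat => /or3P[/s1A[]|/s2A[]|] //.
  by case/flatten_mapP=> j _ /(proj1 (s3P j)) [].
move=> e Ae; case er: (e r) => [j|].
  have [jM|Mj] := ltnP j M.
    have [f fs fe] := proj2 (s3P j) e (conj Ae er).
    exists f => [|q].
      rewrite !mem_cat; apply/or3P; apply: Or33; apply/flatten_mapP; exists j => //.
      by rewrite mem_iota.
    rewrite inE => /orP[/eqP ->|/fe //]; rewrite er.
    by have [_ ->] := proj1 (s3P j) f fs; rewrite /= leqnn.
  have [f fs fe] : exists2 f, f \in s2 & forall q, q \in l -> leo (f q) (e q).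
    by apply: s2P; split=> //; rewrite er.
  exists f => [|q]; first by rewrite !mem_cat fs orbT.
  rewrite inE => /orP[/eqP ->|/fe //]; rewrite er.
  have [_] := s2A f fs; case fr: (f r) => [k|] // _.
  apply: leq_trans Mj; rewrite -[k]/(odflt 0%N (Some k)) -fr.
  exact: (@leq_bigmax_seq _ _ xpredT (fun f => odflt 0%N (f r))).
have [f fs fe] := s1P e (conj Ae er); exists f; first by rewrite mem_cat fs.
by move=> q; rewrite inE => /orP[/eqP ->|/fe //]; rewrite er; case: (f r).
Qed.

Lemma dickson A : exists s : seq {ffun R -> option nat},
  (forall f, f \in s -> A f) /\
  forall e, A e -> exists2 f, f \in s & forall r, leo (f r) (e r).
Proof.
have [s [sA sP]] := dickson_seq (enum R) A; exists s; split=> // e /sP[f fs fe].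
by exists f => // r; apply: fe; rewrite mem_enum.
Qed.

End Dickson.

(** After [#|T|] steps the iteration has reached the greatest fixed point [cofixset F]. *)
Lemma iter_setT_stable (T : finType) (F : {set T} -> {set T}) :
  {homo F : A B / A \subset B} ->
  exists n, iter n F [set: T]%SET \subset F (iter n F [set: T]%SET).
Proof.
move=> Fmono; exists #|T|.
have -> : iter #|T| F [set: T]%SET = cofixset F.
  rewrite /cofixset /fixset; elim: #|T| => [|n IHn] /=; first by rewrite finset.setC0.
  by rewrite IHn /funsetC finset.setCK.
by rewrite (cofixsetK Fmono).
Qed.

(** * Truncated rule counts and infinite trees *)

Section GreatestFixpoint.
Context {X : finType} {K : comPzSemiRingType} (E : poly_system X K) (y0 : X).
Context (habs : absorptive K).
Implicit Types (r q : rule E) (a b : rule E -> nat).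

Definition monv a : K := \prod_q rcoef q ^+ a q.

Lemma monv_le a b : (forall q, (a q <= b q)%N) -> natle (monv b) (monv a).
Proof. by move=> ab; apply: natle_prod => // q _; exact: natle_exp. Qed.

Lemma monvD a b : monv (fun q => (a q + b q)%N) = monv a * monv b.
Proof. by rewrite -big_split; apply: eq_bigr => q _; rewrite exprD. Qed.

Lemma monv_delta r : monv (fun q => (q == r : nat)) = rcoef r.
Proof.
rewrite /monv (bigD1 r) //= eqxx expr1 big1 ?mulr1 // => q qr.
by rewrite (negPf qr).
Qed.

Lemma monv_sum (I : Type) (s : seq I) (a : I -> rule E -> nat) :
  monv (fun q => \sum_(i <- s) a i q)%N = \prod_(i <- s) monv (a i).
Proof.
rewrite /monv exchange_big; apply: eq_bigr => q _.
by rewrite expr_sum.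
Qed.

Context (N : nat).
(* Exponent vectors truncated at [N], so that there are finitely many of them. *)
Let vec := {ffun rule E -> 'I_N.+1}.
Implicit Types (e : vec) (S : {set X * vec}).

Definition rule_bound r (f : nat -> vec) e : Prop :=
  forall q, (minn ((q == r) + \sum_(i <- iota 0 (size (rbody r))) f i q) N <= e q)%N.

Definition derivable S : {set X * vec} :=
  [set p : X * vec | `[< exists r (f : nat -> vec),
     [/\ rhead r = p.1,
         forall i, (i < size (rbody r))%N -> (nth y0 (rbody r) i, f i) \in S &
         rule_bound r f p.2] >]]%SET.

Lemma derivable_mono : {homo derivable : S S' / S \subset S'}.
Proof.
move=> S S' /subsetP SS'; apply/subsetP => p; rewrite !inE => /asboolP[r [f [rp fS fe]]].
by apply/asboolP; exists r, f; split=> // i /fS /SS'.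
Qed.

(** The equation is unfolded [n] times. Truncating a count lowers an exponent and so enlarges the
    monomial, which keeps it above the corresponding term. *)
Lemma fixpoint_dominated (a : {ffun X -> K}) n : sys_op E a = a ->
  forall x, dominated (fun e => (x, e) \in iter n derivable [set: X * vec]%SET)
                      (fun e => monv (fun q => e q)) (a x).
Proof.
move=> aE; elim: n => [|n IHn] x c s cs.
  apply: natle_trans (natle_mulr habs _ _) _.
  (* Before any unfolding all vectors are allowed; the zero vector has monomial 1, which is above
     [a x]. *)
  move: (cs [ffun=> ord0]); rewrite inE /monv => /(_ isT).
  by rewrite big1 ?mulr1 // => q _; rewrite ffunE.
rewrite -aE; apply: (sys_op_dominated (y0 := y0) [ffun=> ord0] IHn) => r f rx fP.
pose d q := ((q == r) + \sum_(i <- iota 0 (size (rbody r))) f i q)%N.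
pose e : vec := [ffun q => inord (minn (d q) N)].
have eE q : e q = minn (d q) N :> nat by rewrite ffunE inordK // ltnS geq_minr.
have /cs : (x, e) \in iter n.+1 derivable [set: X * vec]%SET.
  rewrite inE; apply/asboolP; exists r, f; split=> //= q.
  by rewrite eE.
apply: natle_trans; apply: natleMl.
rewrite -(monv_delta r) -monv_sum -monvD; apply: monv_le => q.
by rewrite eE geq_minl.
Qed.

Lemma min_sum_le (I : eqType) (s : seq I) (a b : I -> nat) d :
  (forall i, i \in s -> minn (a i) N <= b i)%N ->
  (minn (d + \sum_(i <- s) a i) N <= d + \sum_(i <- s) b i)%N.
Proof.
elim: s d => [|i s IHs] d ab; first by rewrite !big_nil geq_minl.
rewrite !big_cons !addnA.
have := ab i (mem_head _ _).
have : forall j, j \in s -> (minn (a j) N <= b j)%N.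
  by move=> j js; apply: ab; rewrite inE js orbT.
move=> /(IHs 0%N); lia.
Qed.

(** Every pair in [S] has a rule leading back into [S], so unfolding can go on forever. Induction on
    the depth then bounds the counts of each truncation of the tree. *)
Lemma derivable_tree S x e : S \subset derivable S -> (x, e) \in S ->
  exists2 T : dtree X K, dtrees E x T &
    forall n, exists a, pyield n (Defs.root T) = monv a /\
      forall q, (minn (a q) N <= e q)%N.
Proof.
move=> /subsetP SS xe.
have [] := @unfold X K E _ (fun y k => (y, k) \in S)
    (fun r k f => rule_bound r f k) x e y0 xe.
  move=> y k /SS; rewrite inE => /asboolP[r [f [rx fS fk]]].
  by exists r, f.
move=> T [st [ET str stP]]; exists T => // n; rewrite -str.
elim: n (Defs.root T) => [|n IHn] v /=.
  exists (fun=> 0%N); split=> [|q]; first by rewrite /monv big1.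
  by rewrite min0n.
have [r [f [-> fv [cs [csu csv cst]]]]] := stP v.
have [a aP] := choice IHn.
exists (fun q => ((q == r) + \sum_(w <- cs) a w q)%N); split.
  rewrite monvD monv_delta monv_sum (big_childrenE _ _ csu csv).
  by congr (_ * _); apply: eq_bigr => w _; have [-> _] := aP w.
move=> q; apply: leq_trans (fv q); rewrite leq_min geq_minr andbT.
have -> : (\sum_(i <- iota 0 (size (rbody r))) f i q = \sum_(w <- cs) st w q)%N.
  by rewrite -(big_map f xpredT (fun k : vec => k q : nat)) -cst big_map.
by apply: min_sum_le => w _; have [_] := aP w.
Qed.

End GreatestFixpoint.

(** * Exchanging the infimum over truncations with a finite sum *)

Section Conclusion.
Context {X : finType} {K : comPzSemiRingType} (E : poly_system X K).
Context (habs : absorptive K) (hcont : fully_continuous K).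

Let cK := fc_complete hcont.

Definition cap (M : nat) (o : option nat) : nat := if o is Some i then minn i M else M.

Definition capv M (o : {ffun rule E -> option nat}) : K := monv (fun q => cap M (o q)).

Lemma capv_tends o : exists l, tends natle (capv^~ o) l.
Proof.
have [l lP] := cc_glb (natle_chain_continuous habs hcont) (capv^~ o).
exists l; split=> // m n mn; apply: monv_le => // q; rewrite /cap.
by case: (o q) => [i|] //; lia.
Qed.

(** The condition on [o] says that some yield lies above the limit of [capv M o]. It does not
    mention [N], which later allows one finite set of vectors for all [N]. *)
Lemma truncated_gfp (a : {ffun X -> K}) x N : sys_op E a = a ->
  dominated
    (fun o : {ffun rule E -> option nat} => exists2 T : dtree X K, dtrees E x T &
       forall b, (forall M, natle b (capv M o)) -> natle b (yield T))
    (capv N) (a x).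
Proof.
move=> aE c s cs.
have [n nP] := iter_setT_stable (@derivable_mono _ _ E x N).
apply: (@fixpoint_dominated _ _ E x habs N a n aE x c s) => e xe.
have [T ET TP] := derivable_tree nP xe.
(* A count that reaches the truncation bound [N] carries no upper bound and is read as infinity. *)
pose o : {ffun rule E -> option nat} :=
  [ffun q => if (e q < N)%N then Some (e q : nat) else None].
have -> : monv (fun q => e q) = capv N o.
  apply: eq_bigr => q _; congr (_ ^+ _); rewrite /o ffunE.
  case: ltnP => eN; first by rewrite /= (minn_idPl (ltnW eN)).
  by apply/eqP; rewrite eqn_leq eN -ltnS ltn_ord.
apply: cs; exists T => // b bo; apply: le_yield => // k.
have [u [-> ue]] := TP k.
(* [M] exceeds every count in the truncation at depth [k], so capping at [M] loses nothing, even
   where [o] is infinite. *)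
pose M := (\sum_q u q)%N.
have uM q : (u q <= M)%N by rewrite /M (bigD1 q) //= leq_addr.
apply: natle_trans (bo M) _; apply: monv_le => // q; rewrite /o ffunE.
by have := ue q; have := uM q; case: ltnP => /=; lia.
Qed.

Lemma gfp_le_yield_sum (a : {ffun X -> K}) x : sys_op E a = a ->
  natle (a x) (yield_sum (dtrees E x)).
Proof.
move=> aE; have [ub _] := ksupP [set s | exists2 T, dtrees E x T & yield T = s] cK.
pose A (o : {ffun rule E -> option nat}) := forall b,
  (forall M, natle b (capv M o)) -> natle b (yield_sum (dtrees E x)).
have [F [FA FP]] := dickson A.
have /choice[l lP] := capv_tends.
have Fl := proj2 (tends_sum (natle_chain_continuous habs hcont) F lP).
apply: (@natle_trans _ (\sum_(f <- F) l f)).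
  apply: (proj2 Fl) => N; rewrite -[a x]mul1r.
  apply: (truncated_gfp aE) => o [T ET To]; rewrite mul1r.
  (* Smaller exponents give larger monomials, so a Dickson representative below [o] bounds
     [capv N o] from above. *)
  have [f fF fo] : exists2 f, f \in F & forall q, leo (f q) (o q).
    apply: FP => b /To bT; apply: natle_trans bT _; apply: ub.
    by exists T.
  apply: natle_trans (natle_sum habs (capv N) fF).
  apply: monv_le => // q; have := fo q; rewrite /cap /leo.
  by case: (f q) => [i|]; case: (o q) => [j|] //; lia.
(* Membership in [A] is applied to [l f], itself a lower bound of all [capv M f]. *)
rewrite big_seq; apply: sum_natle => f /FA; apply.
by have [_ []] := lP f.
Qed.

End Conclusion.

Unset Implicit Arguments.

Theorem theorem17 (K : comPzSemiRingType) (X : finType) (E : poly_system X K)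
    (habs : absorptive K) (hcont : fully_continuous K) :
  exists mu nu : {ffun X -> K},
    is_lfp (sys_op E) mu /\ is_gfp (sys_op E) nu /\
    forall x : X,
      mu x = yield_sum (fun T => dtrees E x T /\ finite_tree T) /\
      nu x = yield_sum (dtrees E x).
Proof.
have cK := fc_complete hcont.
have ge0 (f : {ffun X -> K}) x : natle (([ffun=> 0] : {ffun X -> K}) x) (f x).
  by rewrite ffunE; exact: natle0.
have le1 (f : {ffun X -> K}) x : natle (f x) (([ffun=> 1] : {ffun X -> K}) x).
  by rewrite ffunE; exact: natle1.
have [mu [muE muP mu_least]] := kleene (natge_chain_continuous habs hcont) E ge0.
have [nu [nuE nuP nu_greatest]] := kleene (natle_chain_continuous habs hcont) E le1.
exists mu, nu; split; [|split] => [||x].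
- by split.
- by split.
split; apply: natle_anti.
- have [ub _] := ksupP [set s | exists2 T : dtree X K,
    dtrees E x T /\ finite_tree T & yield T = s] cK.
  apply: (proj2 (muP x)) => n /=; rewrite -[X in natle X]mul1r.
  apply: (iter0_dominated (y0 := x)) => a /(finite_yield_tree habs cK)[T [ET Tfin aT]].
  by rewrite mul1r; apply: natle_trans aT _; apply: ub; exists T.
- have [_ lub] := ksupP [set s | exists2 T : dtree X K,
    dtrees E x T /\ finite_tree T & yield T = s] cK.
  apply: lub => _ [T [[ET <-] Tfin] <-].
  exact: finite_yield_le.
- exact: gfp_le_yield_sum.
- have [_ lub] := ksupP [set s | exists2 T : dtree X K, dtrees E x T & yield T = s] cK.
  apply: lub => _ [T [ET <-] <-]; apply: (proj2 (nuP _)) => n.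
  by apply: natle_trans (yield_le_pyield _ n cK) _; exact: pyield_le_iter.
Qed.
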